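(* There exists a strictly monotone increasing homogeneously multifractal (HM) function $Z:[0,1]\to[0,1]$ with $h_Z(x)=1$ for all $x\in[0,1]$.
   Context: For a locally bounded function $Z$ and $\alpha>0$, $Z\in C^\alpha_{x_0}$ means that there are a polynomial $P$ of degree at most $[\alpha]$ (integer part) and a constant $C>0$ such that $|Z(x)-P(x-x_0)|\le C|x-x_0|^\alpha$ for all $x$ (in the domain of $Z$) in a neighborhood of $x_0$. The pointwise H\''older exponent is $h_Z(x_0)=\sup\{\alpha\ge0: Z\in C^\alpha_{x_0}\}$. With $\dim$ the Hausdorff dimension and $\dim\emptyset=-\infty$, the function $Z:[0,1]\to\mathbb R$ is homogeneously multifractal (HM) if for every non-degenerate subinterval $U\subset[0,1]$ and every $h\ge0$, $\dim\{x\in U:h_Z(x)=h\}=\dim\{x\in[0,1]:h_Z(x)=h\}$. *)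

(* Defs.v *)
From HB Require Import structures.
From mathcomp Require Import all_boot all_order all_algebra.
From mathcomp Require Import all_classical all_reals all_analysis.

Set Implicit Arguments.
Unset Strict Implicit.
Unset Printing Implicit Defensive.

Import Order.TTheory GRing.Theory Num.Theory.
Import numFieldNormedType.Exports.

Local Open Scope classical_set_scope.
Local Open Scope ring_scope.

(* The domain of a function Z is represented by a set D; the values of
   Z : R -> R outside D play no role. *)

(* [size P <= (truncn a).+1] says that P has degree at most the integer part
   of a. For a = 0, [`|x - x0| `^ 0 = 1] also at x = x0, so the condition is
   boundedness of Z near x0. *)
Definition pointwise_holder (R : realType) (D : set R) (Z : R -> R) (a x0 : R)
    : Prop :=
  exists (P : {poly R}) (C : R),
    [/\ (size P <= (Num.truncn a).+1)%N, 0 < C &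
        \forall x \near x0, D x ->
          `|Z x - P.[x - x0]| <= C * `|x - x0| `^ a].

Definition holder_exponent (R : realType) (D : set R) (Z : R -> R) (x0 : R)
    : \bar R :=
  ereal_sup [set a%:E | a in [set a : R | 0 <= a /\ pointwise_holder D Z a x0]].

Definition iso_holder_set (R : realType) (D : set R) (Z : R -> R) (h : \bar R)
    : set R :=
  [set x | D x /\ holder_exponent D Z x = h].

(* The added point 0 only serves to give the empty set diameter 0. *)
Definition diameter (R : realType) (A : set R) : \bar R :=
  ereal_sup (0%E |` [set `|p.1 - p.2|%:E | p in A `*` A]).

(* The term of index s of the Hausdorff sums: diam(A)^s, with 0^0 = 1 for
   nonempty A, while the empty set always contributes 0. *)
Definition hausdorff_gauge (R : realType) (s : R) (A : set R) : \bar R :=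
  if `[< A = set0 >] then 0%E else poweR (diameter A) s.

Definition hausdorff_content (R : realType) (s delta : R) (A : set R)
    : \bar R :=
  ereal_inf [set (\sum_(0 <= i <oo) hausdorff_gauge s (F i))%E
            | F in [set F : nat -> set R | A `<=` \bigcup_i F i /\
                      forall i, (diameter (F i) <= delta%:E)%E]].

Definition hausdorff_measure (R : realType) (s : R) (A : set R) : \bar R :=
  ereal_sup [set hausdorff_content s delta A | delta in [set d : R | 0 < d]].

Definition hausdorff_dim (R : realType) (A : set R) : \bar R :=
  if `[< A = set0 >] then -oo%E
  else ereal_inf
    [set s%:E | s in [set s : R | 0 <= s /\ hausdorff_measure s A = 0%E]].

(* Subintervals may be open, closed or half-open. *)
Definition homogeneously_multifractal (R : realType) (Z : R -> R) : Prop :=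
  forall U : set R, is_interval U -> U `<=` `[0, 1] ->
    (exists x y : R, [/\ U x, U y & x < y]) ->
    forall h : R, 0 <= h ->
      hausdorff_dim (U `&` iso_holder_set `[0, 1] Z h%:E) =
      hausdorff_dim (iso_holder_set `[0, 1] Z h%:E).

(* Main.v *)
Require Import Defs.
From HB Require Import structures.
From mathcomp Require Import all_boot all_order all_algebra.
From mathcomp Require Import all_classical all_reals all_analysis.
From mathcomp Require Import ring lra.

Set Implicit Arguments.
Unset Strict Implicit.
Unset Printing Implicit Defensive.

Import Order.TTheory GRing.Theory Num.Theory.
Import numFieldNormedType.Exports.

Local Open Scope classical_set_scope.
Local Open Scope ring_scope.

(** The witness is the lacunary series
      Z x = x + sum_k 2^-(k+2) 2^-(k^2) tent (2^(k^2) x),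
    where tent is the distance to the nearest integer.  Its k-th wave has
    slopes +-2^-(k+2), whose sum is 1/2, so that all increments of Z lie
    between 1/2 and 3/2 times those of x: Z is strictly increasing, Lipschitz,
    and its pointwise exponent is at least 1 everywhere
    ([lacunary_increment]).

    The slopes decrease geometrically while the frequencies 2^(k^2) grow
    faster than any geometric sequence: the slopes decay more slowly than any
    power of the scale 2^-(k^2), which rules out every exponent a > 1.  To
    see it, measure the deviation from affinity on [u, v] by
      midgap f u v = f u + f v - 2 f ((u + v) / 2).
    On a dyadic interval of length 2^-(n^2) the slower waves are affine,
    the faster ones vanish at the three points, and the n-th wave is a full
    tooth, so the midgap of Z is exactly -2^-(n+2) 2^-(n^2)
    ([midgap_lacunary]).  On the other hand, the pointwise Holder condition
    of exponent a > 1 at x0 bounds the midgap on the dyadic interval around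
    x0 by K (2^-(n^2))^b for some b > 1 ([pointwise_holder_midgap]), which is
    smaller for large n.

    As the exponent is constant, each of its level sets is [0, 1] or empty,
    and homogeneity says that a nondegenerate subinterval of [0, 1] has the
    same Hausdorff dimension as [0, 1].  This holds without
    computing that dimension: each of the two is contained in a Lipschitz
    image of the other, and Lipschitz images preserve nullity of Hausdorff
    measures ([hausdorff_measure_eq0_lipschitz]). *)

(** * The lacunary tent series *)

Section Tent.
Variable R : realType.
Implicit Types x y a b : R.

Definition tent x : R :=
  Num.min (x - (Num.floor x)%:~R) ((Num.floor x)%:~R + 1 - x).

(** Including the right endpoint, where the floor jumps, gives one formula
    on a closed interval, which evaluates [tent] at both ends and in between. *)
Lemma tentE (m : int) x : m%:~R <= x <= m%:~R + 1 ->
  tent x = Num.min (x - m%:~R) (m%:~R + 1 - x).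
Proof.
move=> /andP[mx]; rewrite le_eqVlt => /predU1P[xm|xm].
  have -> : tent x = 0.
    rewrite /tent.
    have -> : Num.floor x = m + 1 by apply: floor_def; rewrite !rmorphD /= xm; lra.
    rewrite rmorphD /= xm; rewrite min_l; lra.
  by rewrite min_r xm; lra.
rewrite /tent (@floor_def _ _ m) // mx rmorphD //.
Qed.

Lemma tent_int (m : int) : tent m%:~R = 0.
Proof. by rewrite (@tentE m) ?min_l; lra. Qed.

Lemma tent_ge0 x : 0 <= tent x.
Proof.
have /andP[] := floor_itv x; rewrite rmorphD /= => h1 h2.
by rewrite /tent le_min; apply/andP; split; lra.
Qed.

Lemma tent_le_dist x (m : int) : tent x <= `|x - m%:~R|.
Proof.
have /andP[] := floor_itv x; rewrite rmorphD /= => h1 h2.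
rewrite /tent ge_min.
have [mx|xm] := leP m (Num.floor x).
  have mx' : m%:~R <= (Num.floor x)%:~R :> R by rewrite ler_int.
  by apply/orP; left; rewrite ger0_norm; lra.
have xm' : (Num.floor x + 1)%:~R <= m%:~R :> R by rewrite ler_int lezD1.
rewrite rmorphD /= in xm'.
by apply/orP; right; rewrite ler0_norm; lra.
Qed.

Lemma tent_attained x : exists m : int, tent x = `|x - m%:~R|.
Proof.
have /andP[] := floor_itv x; rewrite rmorphD /= => h1 h2.
have [h|h] := leP (x - (Num.floor x)%:~R) ((Num.floor x)%:~R + 1 - x).
  by exists (Num.floor x); rewrite /tent min_l // ger0_norm; lra.
exists (Num.floor x + 1); rewrite /tent min_r; last lra.
by rewrite rmorphD /= ler0_norm; lra.
Qed.

(** [tent] is the minimum of the 1-Lipschitz functions |x - m|, m an integer,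
    by the two preceding lemmas. *)
Lemma tent_lipschitz x y : `|tent x - tent y| <= `|x - y|.
Proof.
have half u v : tent u <= `|u - v| + tent v.
  have [m ->] := tent_attained v.
  apply: le_trans (tent_le_dist u m) _.
  by rewrite -(subrKA v) ler_normD.
have h1 := half x y; have h2 := half y x; rewrite distrC in h2.
rewrite ler_norml; lra.
Qed.

(** The deviation of [f] from affinity on [a, b], a second difference; it
    vanishes for affine [f]. *)
Definition midgap (f : R -> R) a b : R := f a + f b - 2 * f ((a + b) / 2).

(** Endpoints and midpoint are integers, the zeros of [tent]. *)
Lemma midgap_tent_fine p j : (0 < p)%N ->
  midgap tent (j%:R * 2 ^+ p) (j.+1%:R * 2 ^+ p) = 0.
Proof.
case: p => // p _.
have -> : j%:R * 2 ^+ p.+1 = (j * 2 ^ p.+1)%N%:~R :> R.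
  by rewrite -pmulrn natrM natrX.
have -> : j.+1%:R * 2 ^+ p.+1 = (j.+1 * 2 ^ p.+1)%N%:~R :> R.
  by rewrite -pmulrn natrM natrX.
rewrite /midgap.
have -> : ((j * 2 ^ p.+1)%N%:~R + (j.+1 * 2 ^ p.+1)%N%:~R) / 2
       = ((j + j.+1) * 2 ^ p)%N%:~R :> R.
  by rewrite -!pmulrn !natrM natrD !natrX exprS; field.
by rewrite !tent_int; lra.
Qed.

Lemma midgap_tent_unit j : midgap tent j%:R j.+1%:R = - 1.
Proof.
have tj i : tent i%:R = 0 by rewrite pmulrn tent_int.
have sj : j.+1%:R = j%:R + 1 :> R by rewrite natr1.
rewrite /midgap !tj (@tentE j%:Z) -!pmulrn sj; last lra.
by rewrite min_l; lra.
Qed.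

(** Since p > 0, the interval lies in one half of a unit interval, on which
    [tent] is affine. *)
Lemma midgap_tent_coarse p j : (0 < p)%N ->
  midgap tent (j%:R / 2 ^+ p) (j.+1%:R / 2 ^+ p) = 0.
Proof.
case: p => // p _.
have e0 : 0 < 2 ^+ p :> R by rewrite exprn_gt0.
rewrite {1 2}(divn_eq j (2 ^ p.+1)).
set q := (j %/ _)%N; set r := (j %% _)%N.
have hr : (r < 2 ^ p.+1)%N by rewrite ltn_mod expn_gt0.
have jE : (q * 2 ^ p.+1 + r)%:R / 2 ^+ p.+1 = q%:R + r%:R / 2 ^+ p.+1 :> R.
  by rewrite natrD natrM natrX mulrDl mulfK ?expf_neq0.
have jE1 : (q * 2 ^ p.+1 + r).+1%:R / 2 ^+ p.+1 = q%:R + r.+1%:R / 2 ^+ p.+1 :> R.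
  by rewrite -addnS natrD natrM natrX mulrDl mulfK ?expf_neq0.
rewrite jE jE1.
set u := r%:R / _; set v := r.+1%:R / _.
have u0 : 0 <= u by rewrite divr_ge0 // exprn_ge0.
have uv : u <= v by rewrite ler_pM2r ?ler_nat // invr_gt0 exprn_gt0.
have v1 : v <= 1.
  by rewrite ler_pdivrMr ?exprn_gt0 // mul1r -natrX ler_nat.
rewrite /midgap !(@tentE q%:Z) -?pmulrn; try lra.
have [h|h] := leqP r.+1 (2 ^ p).
  have v2 : v <= 1 / 2.
    rewrite ler_pdivrMr ?exprn_gt0 // exprS mulrA mul1r mulVf // mul1r.
    by rewrite -natrX ler_nat.
  by rewrite !min_l; lra.
have u2 : 1 / 2 <= u.
  rewrite ler_pdivlMr ?exprn_gt0 // exprS mulrA mul1r mulVf // mul1r.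
  by rewrite -natrX ler_nat.
by rewrite !min_r; lra.
Qed.

(** The slopes of [wave k] are +-2^-(k+2): summable, with sum 1/2, and yet
    decaying more slowly than any power of the wavelength 2^-(k^2). *)
Definition wave k x : R := tent (2 ^+ (k ^ 2) * x) / (2 ^+ (k ^ 2) * 2 ^+ k.+2).

Lemma midgapZ (f : R -> R) c d a b :
  midgap (fun x => f (c * x) / d) a b = midgap f (c * a) (c * b) / d.
Proof.
rewrite /midgap; have -> : (c * a + c * b) / 2 = c * ((a + b) / 2).
  by rewrite -mulrDr mulrA.
by ring.
Qed.

(** A wave of index other than n does not contribute at scale 2^-(n^2):
    if slower it is affine there, if faster it vanishes at the three points. *)
Lemma midgap_wave k n j : let N := (n ^ 2)%N in
  midgap (wave k) (j%:R / 2 ^+ N) (j.+1%:R / 2 ^+ N) =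
    if k == n then - (2 ^+ N * 2 ^+ n.+2)^-1 else 0.
Proof.
move=> N; rewrite midgapZ.
have P0 m : 2 ^+ m != 0 :> R by rewrite expf_neq0.
case: ltngtP => [kn|nk|->].
- have lt : (k ^ 2 < N)%N by rewrite ltn_exp2r.
  have e i : 2 ^+ (k ^ 2) * (i%:R / 2 ^+ N) = i%:R / 2 ^+ (N - k ^ 2) :> R.
    by rewrite -[in LHS](subnK (ltnW lt)) exprD; field; rewrite !P0.
  by rewrite !e midgap_tent_coarse ?subn_gt0 // mul0r.
- have lt : (N < k ^ 2)%N by rewrite ltn_exp2r.
  have e i : 2 ^+ (k ^ 2) * (i%:R / 2 ^+ N) = i%:R * 2 ^+ (k ^ 2 - N) :> R.
    by rewrite -[in LHS](subnK (ltnW lt)) exprD; field; rewrite !P0.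
  by rewrite !e midgap_tent_fine ?subn_gt0 // mul0r.
- have e i : 2 ^+ N * (i%:R / 2 ^+ N) = i%:R :> R by field; rewrite P0.
  by rewrite !e midgap_tent_unit mulNr mul1r.
Qed.

Lemma wave_lipschitz k x y : `|wave k x - wave k y| <= (2 ^+ k.+2)^-1 * `|x - y|.
Proof.
rewrite /wave -mulrBl.
have : 0 < 2 ^+ (k ^ 2) :> R by rewrite exprn_gt0.
have : 0 < 2 ^+ k.+2 :> R by rewrite exprn_gt0.
move: (2 ^+ k.+2) (2 ^+ (k ^ 2)) => c b c0 b0.
rewrite normrM [X in _ * X]gtr0_norm ?invr_gt0 ?mulr_gt0 //.
rewrite ler_pdivrMr ?mulr_gt0 //; apply: le_trans (tent_lipschitz _ _) _.
rewrite -mulrBr normrM gtr0_norm // [b * c]mulrC mulrACA mulVf ?gt_eqF //.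
by rewrite mul1r mulrC.
Qed.

Definition lacunary_partial N x : R := x + \sum_(k < N) wave k x.

Definition lacunary x : R := limn (lacunary_partial^~ x).

(** The slopes 2^-(k+2) of the waves add up to 1/2 - 2^-(N+1). *)
Lemma sum_wave_lipschitz N x y :
  `|\sum_(k < N) wave k x - \sum_(k < N) wave k y| <= `|x - y| / 2.
Proof.
rewrite -sumrB; apply: le_trans (ler_norm_sum _ _ _) _.
apply: (@le_trans _ _ ((2^-1 - (2 ^+ N.+1)^-1) * `|x - y|)); last first.
  by rewrite [leRHS]mulrC ler_wpM2r // gerBl invr_ge0 exprn_ge0.
elim: N => [|N IH]; first by rewrite big_ord0 expr1 subrr mul0r.
rewrite big_ord_recr /=; apply: le_trans (lerD IH (wave_lipschitz _ _ _)) _.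
rewrite -mulrDl ler_wpM2r // [in leRHS]exprS [in X in X <= _](exprS _ N.+1).
by rewrite !invfM; lra.
Qed.

Lemma lacunary_partial_cvg x : lacunary_partial^~ x @ \oo --> lacunary x.
Proof.
apply: nondecreasing_is_cvgn.
  apply/nondecreasing_seqP => N; rewrite lerD2l big_ord_recr /= lerDl.
  by rewrite divr_ge0 ?tent_ge0 // mulr_ge0 ?exprn_ge0.
exists (x + `|x| / 2) => _ [N _ <-]; rewrite lerD2l.
have := sum_wave_lipschitz N x 0.
rewrite subr0 [X in _ - X]big1 => [|k _]; last first.
  by rewrite /wave mulr0 (tent_int 0) mul0r.
by rewrite subr0; apply: le_trans (ler_norm _).
Qed.

(** The waves perturb the identity by a function of Lipschitz constant 1/2,
    hence increments stay positive and Z is bi-Lipschitz. *)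
Lemma lacunary_increment x y : x <= y ->
  (y - x) / 2 <= lacunary y - lacunary x <= (y - x) * (3 / 2).
Proof.
move=> xy.
have c : (fun N => lacunary_partial N y - lacunary_partial N x) @ \oo --> lacunary y - lacunary x.
  by apply: cvgB; exact: lacunary_partial_cvg.
have h N : (y - x) / 2 <= lacunary_partial N y - lacunary_partial N x <= (y - x) * (3 / 2).
  have := sum_wave_lipschitz N y x; rewrite /lacunary_partial (ger0_norm (_ : 0 <= y - x)) ?subr_ge0 // ler_norml.
  lra.
rewrite -(cvg_lim _ c) //; apply/andP; split.
  apply: limr_ge; first by apply: cvgP c.
  by apply: nearW => N; have /andP[] := h N.
apply: limr_le; first by apply: cvgP c.
by apply: nearW => N; have /andP[] := h N.
Qed.

Lemma lacunary_lipschitz x y : `|lacunary x - lacunary y| <= 3 / 2 * `|x - y|.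
Proof.
wlog xy : x y / y <= x => [hw|].
  have [/hw //|/ltW/hw] := leP y x.
  by rewrite distrC (distrC y).
move/andP: (lacunary_increment xy) => [i1 i2]; have xy0 : 0 <= x - y by rewrite subr_ge0.
by rewrite (ger0_norm xy0) ger0_norm; lra.
Qed.

(** Along the partial sums the midgap is eventually constant: only the n-th
    wave contributes. *)
Lemma midgap_lacunary n j : let N := (n ^ 2)%N in
  midgap lacunary (j%:R / 2 ^+ N) (j.+1%:R / 2 ^+ N) =
    - (2 ^+ N * 2 ^+ n.+2)^-1.
Proof.
move=> N; set a := j%:R / _; set b := _ / _.
have c : (fun M => midgap (lacunary_partial M) a b) @ \oo --> midgap lacunary a b.
  apply: cvgB; first by apply: cvgD; exact: lacunary_partial_cvg.
  by apply: cvgM; [exact: cvg_cst|exact: lacunary_partial_cvg].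
rewrite -(cvg_lim _ c) //; apply: lim_near_cst => //.
exists n.+1 => // M /= nM.
have -> : midgap (lacunary_partial M) a b = \sum_(k < M) midgap (wave k) a b.
  rewrite /midgap /lacunary_partial sumrB big_split /= -mulr_sumr.
  by field.
rewrite (bigD1 (Ordinal nM)) //= big1 => [|k kn]; last first.
  by rewrite midgap_wave -(inj_eq val_inj) /= in kn *; rewrite (negbTE kn).
by rewrite midgap_wave eqxx addr0.
Qed.

Lemma lacunary0 : lacunary 0 = 0.
Proof.
apply: cvg_lim => //; rewrite (_ : lacunary_partial^~ 0 = fun=> 0); first exact: cvg_cst.
apply/funext => N; rewrite /lacunary_partial add0r big1 // => k _.
by rewrite /wave mulr0 (tent_int 0) mul0r.
Qed.

Lemma lacunary1 : lacunary 1 = 1.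
Proof.
apply: cvg_lim => //; rewrite (_ : lacunary_partial^~ 1 = fun=> 1); first exact: cvg_cst.
apply/funext => N; rewrite /lacunary_partial big1 ?addr0 // => k _.
by rewrite /wave mulr1 -natrX pmulrn tent_int mul0r.
Qed.

End Tent.

(** * Hausdorff dimension of intervals *)

Section Hausdorff.
Variable R : realType.
Implicit Types (A B : set R) (s d : R).
Local Open Scope ereal_scope.

Lemma diameter_ge0 A : 0 <= diameter A.
Proof. by apply: ereal_sup_ubound; left. Qed.

Lemma diameter_le_lipschitz (f : R -> R) (L : R) A : (0 <= L)%R ->
  (forall x y, `|f x - f y| <= L * `|x - y|)%R ->
  diameter (f @` A) <= L%:E * diameter A.
Proof.
move=> L0 fL; apply: ge_ereal_sup => _ [->|[[_ _] /= [[x Ax <-] [y Ay <-]] <-]].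
  by rewrite mule_ge0 ?lee_fin ?diameter_ge0.
apply: (@le_trans _ _ (L%:E * `|x - y|%:E)); first by rewrite -EFinM lee_fin.
rewrite lee_wpmul2l ?lee_fin //; apply: ereal_sup_ubound; right.
by exists (x, y).
Qed.

Lemma hausdorff_gauge_ge0 s A : 0 <= hausdorff_gauge s A.
Proof. by rewrite /hausdorff_gauge; case: ifP => // _; exact: poweR_ge0. Qed.

Lemma hausdorff_gauge_lipschitz (f : R -> R) (L s : R) A : (0 <= L)%R -> (0 <= s)%R ->
  (forall x y, `|f x - f y| <= L * `|x - y|)%R ->
  hausdorff_gauge s (f @` A) <= (L `^ s)%:E * hausdorff_gauge s A.
Proof.
move=> L0 s0 fL; rewrite /hausdorff_gauge.
case: asboolP => [_|fA].
  by rewrite mule_ge0 ?lee_fin ?powR_ge0 //; case: ifP => // _; exact: poweR_ge0.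
case: asboolP => [A0|_]; first by exfalso; apply: fA; rewrite A0 image_set0.
rewrite -poweR_EFin -poweRM ?lee_fin ?diameter_ge0 //.
apply: gt0_ler_poweR => //; rewrite ?in_itv /= ?leey ?andbT ?diameter_ge0 //.
  by rewrite mule_ge0 ?lee_fin ?diameter_ge0.
exact: diameter_le_lipschitz.
Qed.

Lemma hausdorff_content_ge0 s d A : 0 <= hausdorff_content s d A.
Proof.
apply: le_ereal_inf_tmp => _ [F _ <-].
by apply: nneseries_ge0 => i _ _; exact: hausdorff_gauge_ge0.
Qed.

Lemma hausdorff_measure_eq0P s A :
  hausdorff_measure s A = 0 <->
  (forall d, (0 < d)%R -> hausdorff_content s d A = 0).
Proof.
split=> [H0 d d0|H].
  apply/eqP; rewrite eq_le hausdorff_content_ge0 andbT -H0.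
  by apply: ereal_sup_ubound; exists d.
apply/eqP; rewrite eq_le; apply/andP; split.
  by apply: ge_ereal_sup => _ [d /= d0 <-]; rewrite H.
rewrite -(H 1%R) //; apply: ereal_sup_ubound; exists 1%R => //=.
Qed.

(** The image of a cover of [A] by sets of diameter at most d / L is a cover
    of [B] by sets of diameter at most d, and its sum is multiplied by at most
    L^s. *)
Lemma hausdorff_measure_eq0_lipschitz (f : R -> R) (L s : R) A B :
  (0 < L)%R -> (0 <= s)%R -> (forall x y, `|f x - f y| <= L * `|x - y|)%R ->
  B `<=` f @` A -> hausdorff_measure s A = 0 -> hausdorff_measure s B = 0.
Proof.
move=> L0 s0 fL BfA /hausdorff_measure_eq0P HA.
apply/hausdorff_measure_eq0P => d d0.
apply/eqP; rewrite eq_le hausdorff_content_ge0 andbT.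
apply/lee_addgt0Pr => e e0; rewrite add0e.
have Ls : (0 < L `^ s)%R by rewrite powR_gt0.
have : hausdorff_content s (d / L) A < (e / L `^ s)%:E.
  by rewrite HA ?lte_fin ?divr_gt0.
move=> /ereal_inf_lt [_ [F [AF Fd] <-] Fe].
apply: ge_ereal_inf; exists (\sum_(0 <= i <oo) hausdorff_gauge s (f @` F i)).
  exists (fun i => f @` F i) => //; split.
    move=> y /BfA [x /AF [i _ Fx] <-]; exists i => //; exact: imageP.
  move=> i; apply: le_trans (diameter_le_lipschitz _ (ltW L0) fL) _.
  have -> : d%:E = L%:E * (d / L)%:E.
    by rewrite -EFinM mulrCA divff ?mulr1 // gt_eqF.
  by apply: lee_wpmul2l; [rewrite lee_fin ltW|exact: Fd].
apply: (@le_trans _ _ ((L `^ s)%:E * \sum_(0 <= i <oo) hausdorff_gauge s (F i))).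
  rewrite -nneseriesZl => [|i _]; last exact: hausdorff_gauge_ge0.
  apply: lee_nneseries => [i _ _|i _]; first exact: hausdorff_gauge_ge0.
  exact: hausdorff_gauge_lipschitz (ltW L0) s0 fL.
have -> : e%:E = (L `^ s)%:E * (e / L `^ s)%:E.
  by rewrite -EFinM mulrCA divff ?mulr1 // gt_eqF.
by rewrite lee_wpmul2l ?lee_fin ?(ltW Ls) // ltW.
Qed.

(** The two sets have the same null exponents: [U] is contained in [[a, b]],
    and an affine bijection maps the segment [[x, y]] of [U] onto [[a, b]]. *)
Lemma hausdorff_dim_segment (U : set R) (x y a b : R) :
  (x < y)%R -> U x -> U y -> is_interval U -> (a < b)%R -> U `<=` `[a, b]%classic ->
  hausdorff_dim U = hausdorff_dim `[a, b]%classic.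
Proof.
move=> xy Ux Uy iU ab Uab; rewrite /hausdorff_dim.
case: asboolP => [U0|_]; first by rewrite U0 in Ux.
case: asboolP => [ab0|_].
  by have := Uab _ Ux; rewrite ab0.
congr ereal_inf; congr image; apply/seteqP; split=> s /= [s0 Hs]; split => //.
  have q0 : (0 < (b - a) / (y - x))%R by rewrite divr_gt0 ?subr_gt0.
  (* the affine map sending x to a and y to b *)
  pose f t : R := (a + (b - a) / (y - x) * (t - x))%R.
  apply: (@hausdorff_measure_eq0_lipschitz f _ s U _ q0 s0 _ _ Hs).
    move=> u v; rewrite /f.
    have -> : (a + (b - a) / (y - x) * (u - x) - (a + (b - a) / (y - x) * (v - x))
             = (b - a) / (y - x) * (u - v))%R by ring.
    by rewrite normrM gtr0_norm.
  move=> t /=; rewrite in_itv /= => /andP[at_ tb].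
  exists ((t - a) / ((b - a) / (y - x)) + x)%R.
    apply: (iU x y) => //; rewrite lerDr divr_ge0 ?(ltW q0) ?subr_ge0 //=.
    rewrite -lerBrDr ler_pdivrMr // mulrC divfK ?gt_eqF ?subr_gt0 //.
    by rewrite lerD2r.
  by rewrite /f addrK mulrC divfK ?gt_eqF // addrC subrK.
apply: (@hausdorff_measure_eq0_lipschitz id 1%R s _ U ltr01 s0 _ _ Hs).
  by move=> u v; rewrite mul1r.
by rewrite image_id.
Qed.

End Hausdorff.

(** The level sets of a constant exponent are [0, 1] or empty. *)
Lemma homogeneously_multifractal_cst (R : realType) (Z : R -> R) (c : \bar R) :
  {in `[0, 1]%R, forall x, holder_exponent `[0, 1]%classic Z x = c} ->
  homogeneously_multifractal Z.
Proof.
move=> Zc U iU U01 [x [y [Ux Uy xy]]] h h0.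
have [hc|hc] := eqVneq h%:E c.
  have -> : iso_holder_set `[0%R, 1%R] Z h%:E = `[0%R, 1%R]%classic.
    by apply/seteqP; split=> t /=; [case|move=> t01; split=> //; rewrite Zc].
  by rewrite setIidl //; apply: (hausdorff_dim_segment xy).
have -> : iso_holder_set `[0%R, 1%R] Z h%:E = set0.
  apply/seteqP; split=> t //= [t01 Zt]; move/eqP: hc; apply.
  by rewrite -Zt Zc.
by rewrite setI0.
Qed.


(** * Pointwise exponents of the series *)

Section Exponent.
Variable R : realType.
Implicit Types (x : R) (D : set R) (Z : R -> R).

(** The higher order terms of P are t^2 times a polynomial, bounded for |t| <= 1. *)
Lemma poly_affine_approx (P : {poly R}) : exists c0 c1 K : R,
  0 <= K /\ forall t, `|t| <= 1 -> `|P.[t] - (c0 + c1 * t)| <= K * `|t| ^+ 2.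
Proof.
have [K HK] := poly_disk_bound (drop_poly 2 P) 1.
exists (take_poly 2 P)`_0, (take_poly 2 P)`_1, K; split.
  by apply: le_trans (HK 0 _); rewrite ?normr0.
move=> t t1; rewrite -[P in P.[t]](poly_take_drop 2) hornerD hornerM hornerXn.
rewrite (horner_coef_wide _ (size_take_poly 2 P)) !big_ord_recl big_ord0 /=.
rewrite expr0 expr1 mulr1 addr0 addrC addKr normrM normrX.
by rewrite ler_wpM2r ?exprn_ge0 // HK.
Qed.

Lemma midgap_le (f : R -> R) (c0 c1 u v E : R) :
  {in [:: u; v; (u + v) / 2], forall x, `|f x - (c0 + c1 * x)| <= E} ->
  `|midgap f u v| <= 4 * E.
Proof.
move=> H.
have /ler_normlP[] := H u (mem_head _ _).
have /ler_normlP[] := H v ltac:(by rewrite !inE eqxx orbT).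
have /ler_normlP[] := H ((u + v) / 2) ltac:(by rewrite !inE eqxx !orbT).
move=> *; rewrite /midgap ler_norml; apply/andP; split; lra.
Qed.

(** Near [x0], [Z] is affine up to an error C r^a from the Holder condition
    and an error K r^2 from the terms of degree at least 2 of the polynomial;
    hence the exponent b = min(a, 2). *)
Lemma pointwise_holder_midgap D Z (a x0 : R) : 1 < a -> pointwise_holder D Z a x0 ->
  exists b K e : R, [/\ 1 < b, 0 < K, 0 < e & forall r u v,
    0 < r < e -> D u -> D v -> D ((u + v) / 2) ->
    `|u - x0| <= r -> `|v - x0| <= r -> `|midgap Z u v| <= K * r `^ b].
Proof.
move=> a1 [P [C [_ C0]]] /nbhs_ballP[e /= e0 He].
have [c0 [c1 [K [K0 HK]]]] := poly_affine_approx P.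
exists (Num.min a 2), (4 * (C + K)), (Num.min e 1); split.
- by rewrite lt_min a1 ltr1n.
- by rewrite mulr_gt0 // ltr_wpDr.
- by rewrite lt_min e0 ltr01.
move=> r u v /andP[r0]; rewrite lt_min => /andP[re r1] Du Dv Dw ur vr.
rewrite -mulrA; apply: (@midgap_le Z (c0 - c1 * x0) c1).
have r01 : 0 < r <= 1 by rewrite r0 ltW.
have approx x : D x -> `|x - x0| <= r ->
    `|Z x - (c0 - c1 * x0 + c1 * x)| <= (C + K) * r `^ Num.min a 2.
  move=> Dx xr.
  have t1 : `|x - x0| <= 1 by rewrite (le_trans xr) // ltW.
  have hC : `|x - x0| `^ a <= r `^ Num.min a 2.
    apply: (@le_trans _ _ (r `^ a)).
      by rewrite ge0_ler_powR ?nnegrE ?(ltW r0) // (le_trans _ (ltW a1)).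
    by apply: (ger_powR r01); rewrite ge_min lexx.
  have hK : `|x - x0| ^+ 2 <= r `^ Num.min a 2.
    apply: (@le_trans _ _ (r `^ 2%:R)).
      by rewrite powR_mulrn ?(ltW r0) // lerXn2r ?nnegrE ?(ltW r0).
    by apply: (ger_powR r01); rewrite ge_min lexx orbT.
  have -> : c0 - c1 * x0 + c1 * x = c0 + c1 * (x - x0) by ring.
  rewrite -(subrKA P.[x - x0]); apply: le_trans (ler_normD _ _) _.
  rewrite mulrDl; apply: lerD.
    apply: (le_trans (He x _ Dx)); last by rewrite ler_pM2l.
    by rewrite /ball /= distrC (le_lt_trans xr).
  by apply: (le_trans (HK _ t1)); rewrite ler_wpM2l.
move=> x; rewrite !inE => /or3P[] /eqP->; apply: approx => //.
move: ur vr; rewrite !ler_norml => /andP[? ?] /andP[? ?].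
by apply/andP; split; lra.
Qed.

Lemma dyadic_interval x N : 0 <= x <= 1 -> exists j : nat,
  (0 : R) <= j%:R / 2 ^+ N <= x /\ x <= j.+1%:R / 2 ^+ N <= (1 : R).
Proof.
move=> /andP[x0 x1]; have M0 : 0 < 2 ^+ N :> R by rewrite exprn_gt0.
move: x1; rewrite le_eqVlt => /predU1P[->|x1].
  (* the right end of [0, 1] belongs to the last dyadic interval *)
  exists (2 ^ N).-1; rewrite prednK ?expn_gt0 // natrX divff ?gt_eqF // lexx.
  split => //; rewrite divr_ge0 ?(ltW M0) //= ler_pdivrMr // mul1r -natrX.
  by rewrite ler_nat leq_pred.
have /andP[h1 h2] := trunc_itv (mulr_ge0 x0 (ltW M0)).
exists (Num.truncn (x * 2 ^+ N)); split.
  by rewrite divr_ge0 ?(ltW M0) //= ler_pdivrMr.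
rewrite ler_pdivlMr // ler_pdivrMr // mul1r (ltW h2) /= -natrX ler_nat.
by rewrite -(ltr_nat R) natrX (le_lt_trans h1) // gtr_pMl.
Qed.

(** With r = 2^-(n^2), the exact midgap gives 2^-(n+2) <= K r^(b-1), whereas
    r^(b-1) <= 2^-(2n) as soon as n (b - 1) >= 2; hence 2^n <= 4 K, which fails
    for large n. *)
Lemma lacunary_not_pointwise_holder (a x : R) : 0 <= x <= 1 -> 1 < a ->
  ~ pointwise_holder `[0, 1] (@lacunary R) a x.
Proof.
move=> x01 a1 /(pointwise_holder_midgap a1) [b [K [e [b1 K0 e0 H]]]].
have b0 : 0 < b - 1 by rewrite subr_gt0.
(* the third condition makes the scale 2^-(n^2) smaller than e *)
have [n [n1 n2 n3]] : exists n : nat,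
    [/\ 2 / (b - 1) <= n%:R, 4 * K <= n%:R & e^-1 <= n%:R].
  exists (Num.truncn (2 / (b - 1) + 4 * K + e^-1)).+1.
  have p1 : 0 < 2 / (b - 1) by rewrite divr_gt0.
  have p2 : 0 < e^-1 by rewrite invr_gt0.
  have /trunc_itv/andP[_] : 0 <= 2 / (b - 1) + 4 * K + e^-1 by lra.
  by move=> h; split; lra.
have [j [/andP[u0 ux] /andP[xv v1]]] := dyadic_interval (n ^ 2) x01.
have uv : j.+1%:R / 2 ^+ (n ^ 2) - j%:R / 2 ^+ (n ^ 2) = (2 ^+ (n ^ 2))^-1 :> R.
  by rewrite -mulrBl -natr1 addrC addKr mul1r.
have := midgap_lacunary R n j; rewrite /=.
move: (j.+1%:R / _) (j%:R / _) u0 ux xv v1 uv => v u u0 ux xv v1 uv uvE.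
have n0 : (0 < n)%N by rewrite -(ltr_nat R) (lt_le_trans _ n3) ?invr_gt0.
have nN : (n <= n ^ 2)%N by rewrite expnS expn1 leq_pmulr.
have lt2 m : m%:R < 2 ^+ m :> R by rewrite -natrX ltr_nat ltn_expl.
set r := (2 ^+ (n ^ 2))^-1 in uv.
have r0 : 0 < r by rewrite invr_gt0 exprn_gt0.
have re : 0 < r < e.
  rewrite r0 /= -[e]invrK ltf_pV2 ?posrE ?invr_gt0 ?exprn_gt0 //.
  by rewrite (le_lt_trans n3) // (le_lt_trans _ (lt2 _)) // ler_nat.
have : `|midgap (@lacunary R) u v| <= K * r `^ b.
  by apply: H re _ _ _ _ _; rewrite /= ?in_itv /= ?ler_norml; lra.
rewrite uvE normrN ger0_norm; last by rewrite -exprD invr_ge0 exprn_ge0.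
have -> : b = 1 + (b - 1) by ring.
rewrite powRD; last by rewrite (gt_eqF r0) implybT.
rewrite powRr1 ?(ltW r0) // invfM -/r mulrCA ler_pM2l // => bound.
have small : r `^ (b - 1) <= (2 ^+ (n + n))^-1.
  have -> : r = 2^-1 `^ (n ^ 2)%N%:R by rewrite powR_mulrn ?invr_ge0 // exprVn.
  rewrite -powRrM -exprVn -powR_mulrn ?invr_ge0 //.
  apply: ger_powR; first by rewrite invr_gt0 ltr0n invf_le1 ?ler1n.
  move: n1; rewrite ler_pdivrMr // => n1.
  have := ler_wpM2l (ler0n R n) n1.
  by rewrite natrX expr2 natrD; lra.
have p0 : 0 < 2 ^+ n :> R by rewrite exprn_gt0.
have := le_trans bound (ler_wpM2l (ltW K0) small).
have -> : (2 ^+ n.+2)^-1 = (2 ^+ n) * (2 ^+ (n + n))^-1 / 4 :> R.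
  by rewrite !exprS exprD; field; rewrite gt_eqF.
rewrite mulrAC ler_pM2r ?invr_gt0 ?exprn_gt0 //.
have := lt2 n; lra.
Qed.

Lemma pointwise_holder_lipschitz D Z (L x0 : R) : 0 < L ->
  (forall x, `|Z x - Z x0| <= L * `|x - x0|) -> pointwise_holder D Z 1 x0.
Proof.
move=> L0 ZL; exists (Z x0)%:P, L; split=> //.
  by rewrite (leq_trans (size_polyC_leq1 _)).
by apply/nbhs_ballP; exists 1 => //= x _ _; rewrite hornerC powRr1.
Qed.

Lemma holder_exponent_lacunary x : 0 <= x <= 1 ->
  holder_exponent `[0, 1] (@lacunary R) x = 1%:E.
Proof.
move=> x01; apply/eqP; rewrite eq_le; apply/andP; split.
  apply: ge_ereal_sup => _ [a [a0 Za] <-]; rewrite lee_fin leNgt.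
  by apply/negP => a1; exact: lacunary_not_pointwise_holder x01 a1 Za.
apply: ereal_sup_ubound; exists 1 => //; split=> //.
by apply: (@pointwise_holder_lipschitz _ _ (3 / 2)) => // y; exact: lacunary_lipschitz.
Qed.

End Exponent.

(** * The increasing function of constant exponent 1 *)

Theorem proposition1p15 (R : realType) :
  exists Z : R -> R,
    [/\ set_fun `[0, 1] `[0, 1] Z,
        {in `[0, 1] &, {homo Z : x y / x < y}},
        homogeneously_multifractal Z &
        {in `[0, 1], forall x, holder_exponent `[0, 1] Z x = 1%:E}].
Proof.
have exponent1 : {in `[0, 1], forall x : R,
    holder_exponent `[0, 1] (@lacunary R) x = 1%:E}.
  by move=> x; rewrite in_itv; exact: holder_exponent_lacunary.
have incr (x y : R) : x < y -> lacunary x < lacunary y.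
  by move=> xy; have := lacunary_increment (ltW xy); lra.
exists (@lacunary R); split => //.
- move=> x /=; rewrite !in_itv /= => /andP[x0 x1].
  have := lacunary_increment x0; have := lacunary_increment x1.
  by rewrite lacunary0 lacunary1; lra.
- by move=> x y _ _; exact: incr.
- exact: homogeneously_multifractal_cst exponent1.
Qed.
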